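(* Let $(G,+)$ be a group (not necessarily abelian) with identity $0_G$, let $R$ be a reflexive relation on $G$, and let $A,B$ be nonempty subsets of $G$. Suppose $A$ is finite. Assume that $R$ is transitive and isotone and satisfies property (P5) (relative to $B$). If $A$ is stable and there exists $b\in G$ such that $B=\{0_G,b\}$ and $bI0_G$, then $\mathscr{E}(A+B)\neq\mathscr{E}(A)$.
   Context: For $x,y\in G$, $xPy$ means that $xRy$ holds and $yRx$ does not; $xIy$ means that neither $xRy$ nor $yRx$ holds. $R$ is isotone if for all $g,g',z\in G$, $gRg'$ implies $(z+g)R(z+g')$ and $(g+z)R(g'+z)$. For an integer $p\geq 1$ and $g\in G$, $pg$ is the sum of $p$ copies of $g$. Property (P5): for every $m\geq 1$, all integers $p_1,\dots,p_m\geq 1$ and all $b^1,\dots,b^m\in B$, $0_GR(p_1b^1+\dots+p_mb^m)$ implies that at least one $b^l$ satisfies $0_GRb^l$. The sum set is $A+B=\{a+b: a\in A, b\in B\}$. For $S\subseteq G$, $\mathscr{E}(S)$ is the set of efficient points of $S$, i.e. of those $g\in S$ for which there is no $g'\in S$ with $g'Pg$; by convention $\mathscr{E}(\emptyset)=\emptyset$. A set $S$ is stable if $\mathscr{E}(S)=S$. *)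

(* Defs.v *)
From HB Require Import structures.
From Corelib Require Export RelationClasses.
From mathcomp Require Export all_boot.
From mathcomp Require Export boolp classical_sets cardinality.

Set Implicit Arguments.
Unset Strict Implicit.
Unset Printing Implicit Defensive.

Local Open Scope classical_set_scope.
Local Open Scope group_scope.

(* [groupType] is MathComp's type of possibly infinite, possibly
   noncommutative groups. It is written multiplicatively, so the additive
   g + g', 0_G and p g (p copies of g) read g * g', 1 and g ^+ p here. Its
   choice structure is no restriction classically: boolp provides one on every
   type. *)

Definition strict_part (G : Type) (R : G -> G -> Prop) (x y : G) : Prop :=
  R x y /\ ~ R y x.

Definition incomparable (G : Type) (R : G -> G -> Prop) (x y : G) : Prop :=
  ~ R x y /\ ~ R y x.

Definition isotone (G : groupType) (R : G -> G -> Prop) : Prop :=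
  forall g g' z : G, R g g' -> R (z * g) (z * g') /\ R (g * z) (g' * z).

(* The terms of the product are taken in the order of their indices; the
   family b may have repetitions. *)
Definition P5 (G : groupType) (R : G -> G -> Prop) (B : set G) : Prop :=
  forall (m : nat) (p : 'I_m -> nat) (b : 'I_m -> G),
    (1 <= m)%N -> (forall l, (1 <= p l)%N) -> (forall l, B (b l)) ->
    R 1 (\prod_(l < m) b l ^+ p l) -> exists l, R 1 (b l).

Definition sumset (G : groupType) (A B : set G) : set G :=
  [set a * b | a in A & b in B].

Definition efficient (G : Type) (R : G -> G -> Prop) (S : set G) : set G :=
  [set g | S g /\ ~ exists2 g', S g' & strict_part R g' g].

Definition stable (G : Type) (R : G -> G -> Prop) (S : set G) : Prop :=
  efficient R S = S.

(* Main.v *)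
Require Import Defs.

Local Open Scope classical_set_scope.
Local Open Scope group_scope.

(** Write [M] for the set of efficient points of [A + B], where [B = {0, b}].
    If [M] equalled the set of efficient points of [A], it would lie in [A], so
    for each [a] in [M] the point [a + b] would again be in [A + B].  In a
    finite set every point is dominated by an efficient one
    ([efficient_dominates]), so some [a'] in [M] satisfies [a' R (a + b)].
    Hence no point of [M] is last for the relation
    'there is [n >= 1] with [a' R (a + n b)]'.  By isotonicity that relation is
    transitive ([shift_trans]), and a transitive relation without last
    elements on a nonempty finite set has a loop ([finite_maximal]): some [a]
    satisfies [a R (a + n b)].  Cancelling [a] gives [0 R n b], and (P5) then
    yields [0 R b], against [b I 0]. *)

(** Induction on an enumeration: a new point either lies above the current
    maximal point, and then replaces it, or leaves it maximal. *)
Lemma finite_maximal {T : choiceType} {Q : T -> T -> Prop} {S : set T} :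
  Transitive Q -> finite_set S -> S !=set0 -> (forall x, S x -> ~ Q x x) ->
  exists2 m, S m & forall y, S y -> ~ Q y m.
Proof.
move=> Qtr /finite_seqP[s ->] {S}; elim: s => [|x s IHs] [z zs] Qirr.
  by have : z \in [::] := zs.
have xs : x \in x :: s by rewrite mem_head.
have sub y : y \in s -> y \in x :: s by move=> ys; rewrite in_cons ys orbT.
have [s0|/set0P s_neq0] := eqVneq [set` s] set0.
  exists x => // y /=; rewrite in_cons => /orP[/eqP->|ys]; first exact: Qirr.
  by have : [set` s] y := ys; rewrite s0.
have [|m /= ms mmax] := IHs s_neq0; first by move=> y /= /sub; exact: Qirr.
have [Qxm|nQxm] := pselect (Q x m).
  exists x => // y /=; rewrite in_cons => /orP[/eqP->|ys]; first exact: Qirr.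
  by move=> Qyx; apply: (mmax y ys); exact: Qtr Qyx Qxm.
exists m; first exact: sub.
by move=> y /=; rewrite in_cons => /orP[/eqP->|/mmax].
Qed.

Lemma strict_part_trans {T : Type} {R : T -> T -> Prop} :
  Transitive R -> Transitive (strict_part R).
Proof.
move=> Rtr x y z [Rxy nRyx] [Ryz _]; split; first exact: Rtr Rxy Ryz.
by move=> Rzx; apply: nRyx; exact: Rtr Ryz Rzx.
Qed.

(** A maximal element among the points lying above [x] is efficient in the
    whole of [S], since whatever beats it also lies above [x]. *)
Lemma efficient_dominates {T : choiceType} {R : T -> T -> Prop} {S : set T} :
  Reflexive R -> Transitive R -> finite_set S ->
  forall x, S x -> exists2 e, efficient R S e & R e x.
Proof.
move=> Rrefl Rtr Sfin x Sx; pose U := [set y | S y /\ R y x].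
have Ufin : finite_set U by apply: sub_finite_set Sfin => y [].
have U_neq0 : U !=set0 by exists x; split.
have [|m [Sm Rmx] mmax] :=
  finite_maximal (strict_part_trans Rtr) Ufin U_neq0.
  by move=> y _ [].
exists m => //; split=> // -[y Sy Pym].
by apply: (mmax y) => //; split=> //; apply: Rtr Rmx; case: Pym.
Qed.

(** Commutativity of [G] is replaced by keeping every shift on the right: from
    [x R (y + k b)] and [y R (z + n b)], translating the second by [k b] on the
    right gives [x R (z + n b + k b)]. *)
Lemma shift_trans {G : groupType} {R : G -> G -> Prop} (b : G) :
  Transitive R -> isotone R ->
  Transitive (fun x y => exists n, R x (y * b ^+ n.+1)).
Proof.
move=> Rtr Riso x y z [k Rxy] [n Ryz]; exists (n + k.+1)%N.
have [_ Ryz'] := Riso _ _ (b ^+ k.+1) Ryz.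
by rewrite -addSn expgnDr mulgA; exact: Rtr Rxy Ryz'.
Qed.

Theorem theorem9 (G : groupType) (R : G -> G -> Prop) (A B : set G)
    (R_refl : Reflexive R) (A_neq0 : A !=set0) (B_neq0 : B !=set0)
    (A_fin : finite_set A)
    (R_trans : Transitive R) (R_isotone : isotone R) (R_P5 : P5 R B) :
  stable R A ->
  (exists b : G, B = [set 1; b] /\ incomparable R b 1) ->
  efficient R (sumset A B) <> efficient R A.
Proof.
move=> _ [b [defB [_ nR1b]]] effE.
have Bb : B b by rewrite defB; right.
have ABfin : finite_set (sumset A B).
  by apply: finite_image2 => //; rewrite defB; exact: finite_set2.
have dom := efficient_dominates R_refl R_trans ABfin.
set M := efficient R (sumset A B) in effE dom *.
have Mfin : finite_set M by apply: sub_finite_set ABfin => x [].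
have MA : M `<=` A by rewrite effE => x [].
have M_neq0 : M !=set0.
  have [[a Aa] [c Bc]] := (A_neq0, B_neq0).
  have [|e Me _] := dom (a * c); last by exists e.
  by exists a => //; exists c.
have no_loop x : M x -> ~ exists n, R x (x * b ^+ n.+1).
  move=> _ [n /(R_isotone _ _ x^-1)[+ _]]; rewrite mulVg mulKg => R1nb.
  apply: nR1b; have [||||_ //] := R_P5 1%N (fun=> n.+1) (fun=> b) => //.
  by rewrite big_ord1.
have [m Mm mmax] :=
  finite_maximal (shift_trans b R_trans R_isotone) Mfin M_neq0 no_loop.
have [|e Me Remb] := dom (m * b); first by exists m; [exact: MA|exists b].
by apply: (mmax e Me); exists 0%N; rewrite expg1.
Qed.
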